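(* Let $n\ge 1$. For $0\le i\le n$, the characteristic polynomial of $\Pi^B_{n,i}$ is $$\chi^B_{n,i}(x)=(x-2n)^{n-i},$$ with constant term $(-2n)^{n-i}$. The characteristic polynomial of $\Pi^{B'}_n$ is $$\chi^{B'}_n(x)=(x-1)(x-2n)^{n-1},$$ and its constant term is $(-1)^n(2n)^{n-1}$.
   Context: Write $[n]=\{1,\dots,n\}$ and $[-n]=\{-1,\dots,-n\}$. A partition of type $B_n$ is a partition of $[n]\sqcup[-n]$ such that at most one block (the zero block, if it exists) contains some pair of opposite elements $j,-j$, the zero block is stable under negation, and all other blocks come in pairs of opposite blocks $\{S,-S\}$. A pointed partition of type $B_n$ is a partition of type $B_n$ together with the choice of one element of the zero block (if there is a zero block) and, for each pair of opposite blocks $\{S,-S\}$, the choice of a pair of opposite elements $s\in S$, $-s\in -S$. The chosen elements are called pointed. The poset $\Pi^B_n$ is the set of all pointed partitions of type $B_n$, with $\pi\le\nu$ if and only if the underlying partition of $\pi$ refines that of $\nu$ and the set of pointed elements of $\pi$ contains the set of pointed elements of $\nu$. It has a minimal element $\hat 0$ (all blocks singletons); the rank of $\pi$ is $n$ minus the number of pairs of opposite (non-zero) blocks of $\pi$. There are $2n$ maximal elements (a single zero block with one pointed element); all intervals $[\hat 0,\alpha]$ with $\alpha$ maximal are isomorphic, and $\Pi^{B'}_n$ denotes any such interval. For $1\le i\le n$, $\Pi^B_{n,i}$ is the subposet of $\Pi^B_n$ (with the induced order) of those pointed partitions in which all elements of $\{1,\dots,i\}\cup\{-1,\dots,-i\}$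 are pointed; its maximal elements have rank $n-i$. By convention $\Pi^B_{n,0}=\Pi^B_n$. For a pure finite poset $\Pi$ with minimal element $\hat 0$, rank function $\operatorname{rk}$ and maximal elements of rank $r$, the characteristic polynomial is $\chi(x)=\sum_{a\in\Pi}\mu(a)\,x^{r-\operatorname{rk}(a)}$, where $\mu(a)=\mu(\hat 0,a)$ is the Möbius function of $\Pi$. *)

(* Defs.v *)
From HB Require Import structures.
From mathcomp Require Import all_boot all_order all_algebra.

Set Implicit Arguments.
Unset Strict Implicit.
Unset Printing Implicit Defensive.

Import Order.TTheory GRing.Theory Num.Theory.

(* The Moebius function and the characteristic polynomial of a subposet S (with
   the induced order) of a finite poset T. *)

Section Mobius.
Context {d : Order.disp_t} {T : finPOrderType d}.
Implicit Types (S : {set T}) (a b c : T).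

(* k is fuel: the recursion descends along a chain of T, so k = #|T| suffices
   (see mobius_lt). *)
Fixpoint mobius_rec S (k : nat) a b : int :=
  if k is k'.+1 then
    if a == b then 1%R
    else if (a < b)%O then
      (- \sum_(c in S | (a <= c)%O && (c < b)%O) mobius_rec S k' a c)%R
    else 0%R
  else 0%R.

Definition mobius S a b : int := mobius_rec S #|T| a b.

Lemma mobius_rec_stable S a b k1 k2 :
  #|[set c | (c < b)%O]| < k1 -> #|[set c | (c < b)%O]| < k2 ->
  mobius_rec S k1 a b = mobius_rec S k2 a b.
Proof.
elim: k1 k2 b => [//|k1 IH] [//|k2] b lt1 lt2 /=.
case: eqP => // _; case: ifP => // _; congr (- _)%R.
apply: eq_bigr => c /andP[_ /andP[_ ltcb]].
have ltX : #|[set x | (x < c)%O]| < #|[set x | (x < b)%O]|.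
  apply/proper_card/properP; split.
    by apply/subsetP => x; rewrite !inE => /lt_trans; apply.
  by exists c; rewrite !inE ?ltxx.
by apply: IH; apply: leq_trans ltX _.
Qed.

Lemma card_lt_finPOrder b : #|[set c | (c < b)%O]| < #|T|.
Proof.
rewrite -cardsT; apply/proper_card/properP; split; first exact: subsetT.
by exists b; rewrite !inE ?ltxx.
Qed.

Lemma mobius_rec_fuel S a b :
  mobius S a b = mobius_rec S #|T|.+1 a b.
Proof.
by apply: mobius_rec_stable; rewrite ?ltnS ?card_lt_finPOrder //;
  apply/ltnW/card_lt_finPOrder.
Qed.

Lemma mobius_refl S a : mobius S a a = 1%R.
Proof. by rewrite mobius_rec_fuel /= eqxx. Qed.

Lemma mobius_lt S a b : (a < b)%O ->
  mobius S a b =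
  (- \sum_(c in S | (a <= c)%O && (c < b)%O) mobius S a c)%R.
Proof. by move=> ltab; rewrite mobius_rec_fuel /= (lt_eqF ltab) ltab. Qed.

End Mobius.

(* When S is pure with rank function rk and contains \bot, the maximum of rk on
   S is the common rank r of the maximal elements of S. *)
Definition char_poly_poset {d : Order.disp_t} {T : finBPOrderType d}
    (S : {set T}) (rk : T -> nat) : {poly int} :=
  (\sum_(a in S) mobius S \bot%O a *: 'X^(\max_(b in S) rk b - rk a))%R.

(* (j, true) stands for the element j.+1 of [n] and (j, false) for - j.+1. *)
Definition signed (n : nat) : finType := ('I_n * bool)%type.

Definition opp_signed n (x : signed n) : signed n := (x.1, ~~ x.2).

Definition opp_set n (B : {set signed n}) : {set signed n} :=
  [set opp_signed x | x in B].

Definition is_zero_block n (B : {set signed n}) : bool :=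
  [exists x in B, opp_signed x \in B].

Definition partitionB n (P : {set {set signed n}}) : bool :=
  [&& partition P [set: signed n],
      [forall B in P, forall C in P,
         is_zero_block B ==> is_zero_block C ==> (B == C)],
      [forall B in P, is_zero_block B ==> (opp_set B == B)]
    & [forall B in P, ~~ is_zero_block B ==> (opp_set B \in P)]].

(* A choice of pointed elements is encoded by the set A of all of them. *)
Definition pointing n (P : {set {set signed n}}) (A : {set signed n}) : bool :=
  [forall B in P, #|A :&: B| == 1] &&
  [forall B in P, ~~ is_zero_block B ==>
     (A :&: opp_set B == opp_set (A :&: B))].

Record PiB (n : nat) := MkPiB {
  PiB_val : {set {set signed n}} * {set signed n};
  PiB_valP : partitionB PiB_val.1 && pointing PiB_val.1 PiB_val.2 }.

HB.instance Definition _ n := [isSub for @PiB_val n].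
HB.instance Definition _ n := [Countable of PiB n by <:].
HB.instance Definition _ n := [Finite of PiB n by <:].

Definition blocks n (p : PiB n) : {set {set signed n}} := (PiB_val p).1.
Definition pointed n (p : PiB n) : {set signed n} := (PiB_val p).2.

Definition refines (T : finType) (P Q : {set {set T}}) : bool :=
  [forall B in P, exists C in Q, B \subset C].

Definition leB n : rel (PiB n) := fun p q =>
  refines (blocks p) (blocks q) && (pointed q \subset pointed p).

Lemma blocks_partition n (p : PiB n) : partition (blocks p) [set: signed n].
Proof. by have /andP[/and4P[]] := PiB_valP p. Qed.

Lemma refines_anti (T : finType) (P Q : {set {set T}}) (D E : {set T}) :
  partition P D -> partition Q E -> refines P Q -> refines Q P -> P \subset Q.
Proof.
move=> /and3P[_ tiP P0] _ PQ QP; apply/subsetP => B BP.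
have /exists_inP[C CQ BC] := forall_inP PQ B BP.
have /exists_inP[B' B'P CB'] := forall_inP QP C CQ.
have [x xB] : exists x, x \in B by apply/set0Pn; apply: contraNneq P0 => <-.
have eBB' : B = B'.
  apply: contraTeq xB => neB; have := trivIsetP tiP B B' BP B'P neB.
  move=> disBB'; apply/negP => xB.
  by have := subsetP CB' _ (subsetP BC _ xB); rewrite (disjointFr disBB' xB).
suff -> : B = C by [].
by apply/eqP; rewrite eqEsubset BC /= eBB'.
Qed.

Lemma leB_refl n : reflexive (@leB n).
Proof.
move=> p; rewrite /leB subxx andbT; apply/forall_inP => B BP.
by apply/exists_inP; exists B.
Qed.

Lemma leB_anti n : antisymmetric (@leB n).
Proof.
move=> p q /andP[/andP[pq sqp] /andP[qp spq]].
have [Pp Pq] := (blocks_partition p, blocks_partition q).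
apply: val_inj; case: p q pq qp sqp spq Pp Pq => [[P A] ?] [[Q A'] ?].
rewrite /blocks /pointed /= => PQ QP sA'A sAA' Pp Pq.
congr pair; apply/eqP; rewrite eqEsubset ?sAA' ?sA'A //.
by rewrite (refines_anti Pp Pq) ?(refines_anti Pq Pp).
Qed.

Lemma leB_trans n : transitive (@leB n).
Proof.
move=> q p r /andP[pq sqp] /andP[qr srq]; rewrite /leB (subset_trans srq sqp).
rewrite andbT; apply/forall_inP => B BP.
have /exists_inP[C CQ BC] := forall_inP pq B BP.
have /exists_inP[D DR CD] := forall_inP qr C CQ.
by apply/exists_inP; exists D => //; apply: subset_trans CD.
Qed.

Fact PiB_display : Order.disp_t. Proof. exact: Order.Disp tt tt. Qed.

HB.instance Definition _ n :=
  Order.Le_isPOrder.Build PiB_display (PiB n)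
    (@leB_refl n) (@leB_anti n) (@leB_trans n).

Definition botB_val n : {set {set signed n}} * {set signed n} :=
  ([set [set x] | x : signed n], [set: signed n]).

Lemma opp_set1 n (x : signed n) : opp_set [set x] = [set opp_signed x].
Proof. exact: imset_set1. Qed.

Lemma is_zero_block1 n (x : signed n) : is_zero_block [set x] = false.
Proof.
apply/exists_inP => -[y]; rewrite !inE => /eqP -> /eqP.
by case: x => j [].
Qed.

Lemma botB_valP n :
  partitionB (@botB_val n).1 && pointing (@botB_val n).1 (@botB_val n).2.
Proof.
rewrite /botB_val /=; apply/andP; split; last first.
  apply/andP; split; apply/forall_inP => _ /imsetP[x _ ->].
    by rewrite setTI cards1.
  by rewrite !setTI eqxx implybT.
apply/and4P; split.
- apply/and3P; split.
  + apply/eqP/setP => x; rewrite inE; apply/bigcupP; exists [set x].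
      exact: imset_f.
    by rewrite inE.
  + apply/trivIsetP => _ _ /imsetP[x _ ->] /imsetP[y _ ->] nexy.
    by rewrite disjoints1 inE; apply: contraNneq nexy => ->.
  + by apply/imsetP => -[x _] /setP/(_ x); rewrite !inE eqxx.
- apply/forall_inP => _ /imsetP[x _ ->]; apply/forall_inP => C _.
  by rewrite is_zero_block1.
- by apply/forall_inP => _ /imsetP[x _ ->]; rewrite is_zero_block1.
- apply/forall_inP => _ /imsetP[x _ ->].
  by rewrite opp_set1 imset_f ?implybT.
Qed.

Definition botB n : PiB n := MkPiB (botB_valP n).

Lemma leB_bot n (p : PiB n) : (botB n <= p)%O.
Proof.
apply/andP; split; last exact: subsetT.
apply/forall_inP => _ /imsetP[x _ ->]; apply/exists_inP.
have /and3P[/eqP cov _ _] := blocks_partition p.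
have /bigcupP[C CP xC] : x \in cover (blocks p) by rewrite cov inE.
by exists C; rewrite ?sub1set.
Qed.

HB.instance Definition _ n :=
  Order.hasBottom.Build PiB_display (PiB n) (@leB_bot n).

Definition rankB n (p : PiB n) : nat :=
  n - #|[set [set B; opp_set B] | B in blocks p & ~~ is_zero_block B]|.

(* x.1 is 0-based: x.1 < i means that x is one of 1, ..., i, -1, ..., -i. *)
Definition PiBi (n i : nat) : {set PiB n} :=
  [set p : PiB n | [forall x : signed n, (x.1 < i) ==> (x \in pointed p)]].

Lemma PiBi0 n : PiBi n 0 = [set: PiB n].
Proof. by apply/setP => p; rewrite !inE; apply/forallP. Qed.

Lemma bot_PiBi n i : \bot%O \in PiBi n i.
Proof. by rewrite inE; apply/forallP => x; rewrite inE implybT. Qed.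

Definition is_maximal {d : Order.disp_t} {T : porderType d} (a : T) : Prop :=
  forall b : T, ~~ (a < b)%O.

Definition down_interval {d : Order.disp_t} {T : finBPOrderType d} (a : T) :
  {set T} := [set b | (\bot <= b <= a)%O].

(* Main.v *)
(* Partial functions f from [n] to [n] \cup [-n], extended by f(-x) = -f(x), are the objects
   counted by the characteristic polynomials. The components of f that contain a root (a point
   where f is undefined) are trees, pointed at their roots and forming opposite pairs; the
   union of the others is a zero block, pointed at an arbitrary element o. The rank of the
   resulting pointed partition is the size of the domain of f.

   The Moebius value mu(p) is the sum of (-1)^|dom f| / max(1, |zero block of f|) over the
   f that yield p. Indeed the sum of these values over a <= b vanishes for b <> 0:
   - if b has a zero block, pointed at s, then for the pairs (f, o) below b either s is a root
     of f or s = o lies in the zero block Z of f. Deleting f(s) maps the second case to the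
     first, and each fibre consists of |Z| functions, all with zero block Z, so it cancels;
   - otherwise choose a block with at least two elements, pointed at s, and attach to s, or
     detach from it, an element t of this block that is either a root or mapped to s.
   The characteristic polynomial of Pi^B_{n,i} is then the sum over the f undefined on [i] of
   (-1)^|dom f| x^(n-i-|dom f|), that is (x - 2n)^(n-i), and the deletion argument gives that of
   the maximal intervals. *)
Require Import Defs.
From mathcomp Require Import all_boot all_order all_algebra.

Import GRing.Theory.
Local Open Scope ring_scope.

Set Implicit Arguments.
Unset Strict Implicit.
Unset Printing Implicit Defensive.
Import Order.TTheory Num.Theory.

(** * The Moebius function of a lower set *)

Section MobiusLowerSet.
Context {d : Order.disp_t} {T : finBPOrderType d}.

(** Everything below an element of [S] is in [S], so [mobius] on [S] obeys the recursion that the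
    interval sums impose on [g]. A general ring [R] is allowed because the weights used later are
    rational. *)
Lemma mobius_lower_set (R : pzRingType) (S : {set T}) (g : T -> R) :
  (forall a b : T, (a <= b)%O -> b \in S -> a \in S) ->
  (forall b, \sum_(a | (a <= b)%O) g a = (b == \bot%O)%:R) ->
  forall b, b \in S -> (mobius S \bot%O b)%:~R = g b.
Proof.
move=> lowS sumg b.
have [m] := ubnP #|[set c | (c < b)%O]|; elim: m b => // m IH b ltm Sb.
have gb : g b = (b == \bot%O)%:R - \sum_(c | (c < b)%O) g c.
  rewrite -sumg (bigD1 b) //= [X in _ + X - _](eq_bigl (fun c => c < b)%O) ?addrK //.
  by move=> c; rewrite lt_neqAle andbC.
have [eb|neb] := eqVneq b \bot%O.
  rewrite gb {1}eb mobius_refl eb eqxx big1 ?subr0 // => c.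
  by rewrite ltx0.
rewrite mobius_lt ?lt0x // gb (negPf neb) sub0r rmorphN rmorph_sum /=.
congr (- _); rewrite big_mkcond [RHS]big_mkcond; apply: eq_bigr => c _.
rewrite le0x /=; case: (boolP (c < b)%O) => [ltcb|_]; last by rewrite andbF.
have Sc := lowS _ _ (ltW ltcb) Sb; rewrite Sc /= IH //.
apply: leq_trans (_ : #|[set x | (x < b)%O]| <= m)%N; last by rewrite -ltnS.
apply/proper_card/properP; split; last by exists c; rewrite !inE ?ltxx.
by apply/subsetP => x; rewrite !inE => /lt_trans; apply.
Qed.

End MobiusLowerSet.

(** * Partial functions and their cycles *)

Section Key.
Context {T : finType}.
Implicit Types (F : T -> option T) (x y r : T).

(* The root reached from [x] by iterating [F], or [None] if the iteration runs into a cycle. *)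
Definition key F x : option T :=
  [pick r | (F r == None) && connect (fun u v => F u == Some v) x r].

Lemma connect_root F x r :
  F x = None -> connect (fun u v => F u == Some v) x r = (r == x).
Proof.
move=> Fx; apply/connectP/eqP => [[[|y p] /=]|->]; last by exists [::].
  by move=> _ ->.
by rewrite Fx.
Qed.

Lemma key_root F x : F x = None -> key F x = Some x.
Proof.
move=> Fx; rewrite /key; case: pickP => [r /andP[_]|/(_ x)].
  by rewrite connect_root // => /eqP ->.
by rewrite Fx connect0.
Qed.

Lemma key_step F x y : F x = Some y -> key F x = key F y.
Proof.
move=> Fx; apply: eq_pick => r /=; case: eqP => //= Fr.
apply/connectP/idP => [[[|z p] /=]|/connectP[p pp ->]].
- by move=> _ exr; rewrite exr Fx in Fr.
- by rewrite Fx => /andP[/eqP[<-]] pp ->; apply/connectP; exists p.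
by exists (y :: p) => //=; rewrite Fx eqxx.
Qed.

Lemma key_ind F (P : T -> T -> Prop) :
  (forall x, F x = None -> P x x) ->
  (forall x y r, F x = Some y -> key F y = Some r -> P y r -> P x r) ->
  forall x r, key F x = Some r -> P x r.
Proof.
move=> P0 PS x r kx; have kx' := kx; move: kx'; rewrite {1}/key.
case: pickP => // q /andP[/eqP Fr /connectP[p]] + + [er].
rewrite {}er in Fr *; move=> {q} pp lp.
elim: p x kx pp lp => [|y p IH] x kx /=; first by move=> _ <-; apply: P0.
move=> /andP[/eqP Fxy pp] lp; have ky : key F y = Some r by rewrite -(key_step Fxy).
exact: PS Fxy ky (IH y ky pp lp).
Qed.

Lemma key_rootP F x r : key F x = Some r -> F r = None.
Proof. by move: x r; apply: key_ind. Qed.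

(** An orbit that stays where [F] is defined never meets a root; this detects cyclic components
    without exhibiting a cycle. *)
Lemma key_closed F (A : pred T) x :
  (forall y, A y -> exists2 z, F y = Some z & A z) -> A x -> key F x = None.
Proof.
move=> clA; case kx: (key F x) => [r|] // Ax; move: x r kx Ax.
apply: key_ind => [x Fx /clA[z]|x y r Fx _ IH /clA[z]]; rewrite Fx // => -[<-].
exact: IH.
Qed.

End Key.

(* [Some v] at [j] sends [(j, true)] to [v] and, by antisymmetry, [(j, false)] to [- v]. *)
Notation pfun n := {ffun 'I_n -> option (signed n)}.

Section Signed.
Context {n : nat}.
Implicit Types (x y s v : signed n) (f : pfun n).

Lemma opp_signedK : involutive (@opp_signed n).
Proof. by case=> j b; rewrite /opp_signed /= negbK. Qed.

Lemma opp_signed_neq x : opp_signed x != x.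
Proof. by case: x => j [] /=; apply/eqP => -[]. Qed.

Lemma eq_fst_signed x y : (x.1 == y.1) = (x == y) || (x == opp_signed y).
Proof.
case: x y => i b [j c]; rewrite /opp_signed !xpair_eqE /=.
by case: (i == j) => //=; case: b; case: c.
Qed.

Definition extend f x : option (signed n) :=
  omap (fun v => if x.2 then v else opp_signed v) (f x.1).

Lemma extend_opp f x :
  extend f (opp_signed x) = omap (@opp_signed n) (extend f x).
Proof. by case: x => j []; rewrite /extend /=; case: (f j) => //= v; rewrite opp_signedK. Qed.

Lemma extend_None f x : (extend f x == None) = (f x.1 == None).
Proof. by rewrite /extend; case: (f _). Qed.

Lemma key_opp f x :
  key (extend f) (opp_signed x) = omap (@opp_signed n) (key (extend f) x).
Proof.
have kS : forall y r, key (extend f) y = Some r ->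
    key (extend f) (opp_signed y) = Some (opp_signed r).
  apply: key_ind => [y fy|y z r fy kz IH].
    by apply: key_root; rewrite extend_opp fy.
  by rewrite (@key_step _ _ _ (opp_signed z)) // extend_opp fy.
case kx: (key _ x) => [r|] /=; first exact: kS.
by case ko: (key _ _) => [r|] //; move/kS: ko; rewrite opp_signedK kx.
Qed.

(* The union of the components of [f] that contain a cycle, that is, the zero block of [f]. *)
Definition zeros f : {set signed n} := [set x | key (extend f) x == None].

Definition dom f : {set 'I_n} := [set j | f j != None].

Definition erase (j : 'I_n) f := [ffun k => if k == j then None else f k].

Definition update f s v := [ffun k => if k == s.1 then
  Some (if s.2 then v else opp_signed v) else f k].

Lemma extend_updateE f s v x : extend (update f s v) x =
  if x == s then Some v else if x == opp_signed s then Some (opp_signed v)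
  else extend f x.
Proof.
rewrite /extend /update ffunE eq_fst_signed.
have [->|nxs] /= := eqVneq x s; first by case: (s.2); rewrite //= opp_signedK.
have [->|nxo] //= := eqVneq x (opp_signed s).
by case: (s.2); rewrite //= opp_signedK.
Qed.

(* The vertices whose component becomes cyclic when [s] is sent to one of them. *)
Definition absorbed f s : {set signed n} :=
  [set x | key (extend f) x \in [:: None; Some s; Some (opp_signed s)]].

Lemma in_absorbed f s x r : key (extend f) x = Some r ->
  (x \in absorbed f s) = (r == s) || (r == opp_signed s).
Proof. by move=> kx; rewrite inE kx !inE !(inj_eq Some_inj). Qed.

Lemma absorbed_self f s : f s.1 = None -> s \in absorbed f s.
Proof.
by move=> fs; rewrite inE key_root ?inE ?eqxx ?orbT // /extend fs.
Qed.

Lemma absorbed_opp f s x : (opp_signed x \in absorbed f s) = (x \in absorbed f s).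
Proof.
rewrite !inE key_opp; case: (key _ x) => [r|] //=.
rewrite !(inj_eq Some_inj) (inj_eq (can_inj opp_signedK)) orbC.
by rewrite (can2_eq opp_signedK opp_signedK).
Qed.

(** The path from [x] to [r] avoids [s] and [- s], which are roots of [f] other than [r], so the
    update leaves it intact. *)
Lemma key_update_out f s v x r :
  r != s -> r != opp_signed s -> f s.1 = None -> key (extend f) x = Some r ->
  key (extend (update f s v)) x = Some r.
Proof.
move=> rs ro fs kx; move: x r kx rs ro.
have key_s : key (extend f) s = Some s by rewrite key_root // /extend fs.
have key_o : key (extend f) (opp_signed s) = Some (opp_signed s).
  by rewrite key_opp key_s.
apply: key_ind => [x fx xs xo|x y r fx ky IH rs ro].
  by rewrite key_root // extend_updateE (negPf xs) (negPf xo).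
have kx : key (extend f) x = Some r by rewrite (key_step fx).
rewrite (@key_step _ _ x y) ?IH // extend_updateE.
case: eqVneq => [ex|_]; first by move: rs; rewrite ex key_s in kx; case: kx => ->; rewrite eqxx.
case: eqVneq => [ex|_] //.
by move: ro; rewrite ex key_o in kx; case: kx => ->; rewrite eqxx.
Qed.

(** If [v] leads to a cycle, to [s] or to [- s], the new arrow drives everything hanging from [s]
    and [- s] into a cycle; when [v] leads to [- s], that cycle passes through both, by
    antisymmetry. Otherwise the two trees are grafted onto other trees. *)
Lemma zeros_update f s v : f s.1 = None ->
  zeros (update f s v) = if v \in absorbed f s then absorbed f s else zeros f.
Proof.
move=> fs; have key_s : key (extend f) s = Some s by rewrite key_root // /extend fs.
have key_o : key (extend f) (opp_signed s) = Some (opp_signed s).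
  by rewrite key_opp key_s.
have out x r : key (extend f) x = Some r -> x \notin absorbed f s ->
    key (extend (update f s v)) x = Some r.
  move=> kx; rewrite (in_absorbed _ kx) negb_or => /andP[? ?].
  exact: key_update_out kx.
case: ifPn => [vA|vA]; apply/setP => x.
  apply/idP/idP => [|xA].
    apply: contraLR => xA; case kx: (key (extend f) x) => [r|]; last first.
      by rewrite !inE kx in xA.
    by rewrite inE (out x r).
  rewrite inE; apply/eqP; apply: (@key_closed _ _ (mem (absorbed f s))) => //= y.
  move=> yA; rewrite extend_updateE; case: eqVneq => [ey|ys].
    by exists v.
  case: eqVneq => [ey|yo]; first by exists (opp_signed v); rewrite ?absorbed_opp.
  case fy: (extend f y) => [z|].
    by exists z => //; move: yA; rewrite !inE (key_step fy).
  by move: yA; rewrite (in_absorbed _ (key_root fy)) (negPf ys) (negPf yo).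
apply/idP/idP => [|].
  rewrite !inE; case kx: (key (extend f) x) => [r|] //.
  case kv: (key (extend f) v) => [w|]; last by rewrite !inE kv in vA.
  have kv' := out _ _ kv vA.
  have kS : key (extend (update f s v)) s = Some w.
    by rewrite (@key_step _ _ s v) // extend_updateE eqxx.
  have [xA|/(out _ _ kx) -> //] := boolP (x \in absorbed f s).
  move: xA; rewrite (in_absorbed _ kx) => rs.
  (* A vertex that used to end at [s] or [- s] now continues to the root [w] or [- w]. *)
  have reach : forall y q, key (extend f) y = Some q ->
      (q == s) || (q == opp_signed s) -> key (extend (update f s v)) y != None.
    apply: key_ind => [y fy|y z q fy kz IH qs].
      by case/orP => /eqP ->; rewrite ?key_opp kS.
    case: (eqVneq y s) => [->|ys]; first by rewrite kS.
    case: (eqVneq y (opp_signed s)) => [->|yo]; first by rewrite key_opp kS.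
    by rewrite (@key_step _ _ y z) ?IH // extend_updateE (negPf ys) (negPf yo).
  by rewrite (negPf (reach _ _ kx rs)).
move=> xZ; rewrite inE; apply/eqP.
apply: (@key_closed _ _ (mem (zeros f))) => //= y; rewrite inE => /eqP ky.
have ys : y != s by apply: contra_eqN ky => /eqP ->; rewrite key_s.
have yo : y != opp_signed s by apply: contra_eqN ky => /eqP ->; rewrite key_o.
rewrite extend_updateE (negPf ys) (negPf yo).
case fy: (extend f y) => [z|]; last by rewrite key_root in ky.
by exists z; rewrite // inE -(key_step fy) ky.
Qed.

Lemma erase_update f s v : f s.1 = None -> erase s.1 (update f s v) = f.
Proof.
by move=> fs; apply/ffunP => j; rewrite !ffunE; case: eqP => // ->.
Qed.

Lemma update_erase f s v : extend f s = Some v -> update (erase s.1 f) s v = f.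
Proof.
move=> fs; apply/ffunP => j; rewrite !ffunE; case: eqP => // ->.
move: fs; rewrite /extend; case: (f _) => //= w [<-].
by case: (s.2); rewrite ?opp_signedK.
Qed.

Lemma dom_update f s v : f s.1 = None -> #|dom (update f s v)| = #|dom f|.+1.
Proof.
move=> fs; suff -> : dom (update f s v) = s.1 |: dom f.
  by rewrite cardsU1 inE fs eqxx.
by apply/setP => j; rewrite !inE ffunE; case: (j == s.1).
Qed.

(* Every partial function undefined at [s] has [#|absorbed f s|] extensions with [s] in the
   zero block, and [absorbed f s] is the zero block of each of them. *)
Lemma sum_zeros (V : lmodType rat) s (G : pfun n -> V) :
  \sum_(f : pfun n | s \in zeros f) #|zeros f|%:R^-1 *: G (erase s.1 f)
  = \sum_(f : pfun n | f s.1 == None) G f.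
Proof.
rewrite (partition_big (erase s.1) (fun f : pfun n => f s.1 == None)) /=; last first.
  by move=> f _; rewrite ffunE eqxx.
apply: eq_bigr => f /eqP fs.
have sA := absorbed_self fs.
(* The fibre of [erase] over [f] consists of the updates of [f] at [s] by the elements of
   [absorbed f s]. *)
have -> : \sum_(h : pfun n | (s \in zeros h) && (erase s.1 h == f))
    #|zeros h|%:R^-1 *: G (erase s.1 h) =
    \sum_(h in update f s @: absorbed f s) #|absorbed f s|%:R^-1 *: G f.
  apply: eq_big => [h|h /andP[sz /eqP eh]].
    apply/andP/imsetP => [[sz /eqP eh]|[v vA ->]]; last first.
      by rewrite zeros_update // vA erase_update.
    case hs: (extend h s) => [v|].
      have eh' : h = update f s v by rewrite -eh update_erase.
      exists v => //; move: sz; rewrite {1}eh' zeros_update //.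
      case: ifP => // _; rewrite inE key_root //.
      by rewrite /extend fs.
    by rewrite inE key_root in sz.
  rewrite eh; congr (_ *: _); congr (_%:R^-1).
  case hs: (extend h s) => [v|]; last by rewrite inE key_root in sz.
  have eh' : h = update f s v by rewrite -eh update_erase.
  move: sz; rewrite eh' zeros_update //; case: ifP => // _.
  by rewrite inE key_root // /extend fs.
rewrite sumr_const card_imset; last first.
  move=> v w /(congr1 (fun h => extend h s)).
  by rewrite !extend_updateE eqxx => -[].
rewrite -scaler_nat scalerA divff ?scale1r // pnatr_eq0 -lt0n.
by apply/card_gt0P; exists s.
Qed.

(** Expand one factor [c - 2n] for each index of [A]: leaving the index out of the domain gives [c],
    and each of the [2n] signed values gives [-1]. *)
Lemma sum_partial_functions (R : comPzRingType) (A : {set 'I_n}) (c : R) :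
  \sum_(f : pfun n | dom f \subset A) (-1) ^+ #|dom f| * c ^+ (#|A| - #|dom f|)
  = (c - (2 * n)%:R) ^+ #|A|.
Proof.
pose G (o : option (signed n)) := if o is None then c else -1.
have <- : \prod_(j in A) \sum_(o : option (signed n)) G o = (c - (2 * n)%:R) ^+ #|A|.
  rewrite prodr_const; congr (_ ^+ _).
  rewrite (bigD1 None) //=; congr (_ + _).
  rewrite (eq_bigr (fun _ => -1)); last by case.
  rewrite sumr_const -mulNrn; congr (_ *+ _).
  have -> : #|[pred o : option (signed n) | o != None]| = #|{: signed n}|.
    rewrite -[RHS](card_imset predT Some_inj); apply: eq_card => -[x|]; rewrite !inE /=.
      by rewrite imset_f.
    by apply/esym/negbTE/imsetP => -[].
  by rewrite card_prod card_ord card_bool mulnC.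
rewrite (big_distr_big_dep None) /=.
apply: eq_big => [f|f sfA].
  apply/subsetP/pfamilyP => [sfA|[sfA _] j].
    by split=> //; apply/subsetP => j; rewrite inE => fj; apply: sfA; rewrite inE.
  by rewrite inE => fj; apply: (subsetP sfA).
rewrite (bigID (fun j => f j == None)) /= [RHS]mulrC.
rewrite [X in _ = X * _](eq_bigr (fun _ => -1)); last first.
  by move=> j /andP[_]; rewrite /G; case: (f j).
rewrite [X in _ = _ * X](eq_bigr (fun _ => c)); last by move=> j /andP[_ /eqP ->].
rewrite !prodr_const; congr (_ ^+ _ * _ ^+ _).
  apply: eq_card => j; rewrite [RHS]unfold_in inE.
  case: (boolP (f j == None)) => [_|fj]; rewrite ?andbF // andbT.
  by apply/esym/(subsetP sfA); rewrite inE.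
apply/esym/(canRL (addnK _)); rewrite -[RHS](cardsID (dom f)) addnC; congr (_ + _)%N.
  by congr #|pred_of_set _|; apply/esym/setIidPr.
by apply: eq_card => j; rewrite !inE negbK andbC.
Qed.

End Signed.

(** * Pointed partitions as idempotent maps *)

Section Representative.
Context {n : nat}.
Implicit Types (p q : PiB n) (x y : signed n).

(* A pointed partition is determined by the idempotent map sending [x] to the pointed element
   of its block; the order and the rank are easy to read on this map. *)
Definition rep p x : signed n :=
  odflt x [pick y in pointed p :&: pblock (blocks p) x].

Lemma mem_cover_blocks p x : x \in cover (blocks p).
Proof. by have /and3P[/eqP -> _ _] := blocks_partition p; rewrite inE. Qed.

Lemma blocks_trivIset p : trivIset (blocks p).
Proof. by have /and3P[] := blocks_partition p. Qed.

Lemma pblock_blocks p x : pblock (blocks p) x \in blocks p.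
Proof. by rewrite pblock_mem ?mem_cover_blocks. Qed.

Lemma blocks_pblock p B : B \in blocks p -> exists x, B = pblock (blocks p) x.
Proof.
move=> BP; have /and3P[_ ti B0] := blocks_partition p.
have [x xB] : exists x, x \in B by apply/set0Pn; apply: contraNneq B0 => <-.
by exists x; rewrite (def_pblock ti BP xB).
Qed.

Lemma pointed_pblock p x : pointed p :&: pblock (blocks p) x = [set rep p x].
Proof.
have /andP[_ /andP[/forall_inP pt _]] := PiB_valP p.
have /cards1P[y ey] := pt _ (pblock_blocks p x).
rewrite /rep /pointed ey; case: pickP => [z|/(_ y)]; last by rewrite !inE eqxx.
by rewrite inE => /eqP ->.
Qed.

Lemma rep_pointed p x : rep p x \in pointed p.
Proof.
by have := set11 (rep p x); rewrite -pointed_pblock inE => /andP[].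
Qed.

Lemma rep_pblock p x : rep p x \in pblock (blocks p) x.
Proof.
by have := set11 (rep p x); rewrite -pointed_pblock inE => /andP[].
Qed.

Lemma rep_uniq p x y :
  y \in pointed p -> y \in pblock (blocks p) x -> y = rep p x.
Proof.
by move=> yA yB; apply/set1P; rewrite -pointed_pblock inE yA.
Qed.

Lemma mem_pblock_rep p x y :
  (y \in pblock (blocks p) x) = (rep p y == rep p x).
Proof.
have ti := blocks_trivIset p.
apply/idP/eqP => [yx|exy].
  apply: rep_uniq; first exact: rep_pointed.
  by rewrite -(same_pblock ti yx) rep_pblock.
rewrite -(same_pblock ti (rep_pblock p x)) -exy (same_pblock ti (rep_pblock p y)).
by rewrite mem_pblock mem_cover_blocks.
Qed.

Lemma pointedE p x : (x \in pointed p) = (rep p x == x).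
Proof.
apply/idP/eqP => [xA|<-]; last exact: rep_pointed.
by apply/esym/rep_uniq; rewrite // mem_pblock mem_cover_blocks.
Qed.

Lemma rep_idem p x : rep p (rep p x) = rep p x.
Proof. by apply/eqP; rewrite -pointedE rep_pointed. Qed.

Lemma zero_block_pblock p x :
  is_zero_block (pblock (blocks p) x) = (rep p (opp_signed x) == rep p x).
Proof.
have /andP[/and4P[_ _ /forall_inP st _] _] := PiB_valP p.
have BP := pblock_blocks p x.
apply/idP/eqP => [z|e].
  have /eqP eB := implyP (st _ BP) z.
  apply/eqP; rewrite -mem_pblock_rep -eB imset_f // mem_pblock.
  exact: mem_cover_blocks.
apply/exists_inP; exists x; first by rewrite mem_pblock_rep.
by rewrite mem_pblock_rep e.
Qed.

Lemma rep_zero_stable p x y : rep p (opp_signed x) = rep p x ->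
  rep p y = rep p x -> rep p (opp_signed y) = rep p x.
Proof.
move=> zx yx; have eB : pblock (blocks p) x = pblock (blocks p) y.
  by apply: same_pblock (blocks_trivIset p) _; rewrite mem_pblock_rep yx.
by apply/eqP; rewrite -yx -zero_block_pblock -eB zero_block_pblock zx.
Qed.

Lemma rep_zero_uniq p x y : rep p (opp_signed x) = rep p x ->
  rep p (opp_signed y) = rep p y -> rep p x = rep p y.
Proof.
move=> /eqP zx /eqP zy.
have /andP[/and4P[_ /forall_inP un _ _] _] := PiB_valP p.
have /implyP := forall_inP (un _ (pblock_blocks p x)) _ (pblock_blocks p y).
rewrite !zero_block_pblock => /(_ zx) /implyP /(_ zy) /eqP e.
by apply/eqP; rewrite -mem_pblock_rep -e mem_pblock mem_cover_blocks.
Qed.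

Lemma pblock_opp p x : rep p (opp_signed x) != rep p x ->
  pblock (blocks p) (opp_signed x) = opp_set (pblock (blocks p) x).
Proof.
rewrite -zero_block_pblock => nz.
have /andP[/and4P[_ _ _ /forall_inP ob] _] := PiB_valP p.
have oB := implyP (ob _ (pblock_blocks p x)) nz.
apply: def_pblock (blocks_trivIset p) oB _.
by rewrite imset_f // mem_pblock mem_cover_blocks.
Qed.

Lemma rep_opp p x : rep p (opp_signed x) != rep p x ->
  rep p (opp_signed x) = opp_signed (rep p x).
Proof.
move=> nz; have nz' := nz; rewrite -zero_block_pblock in nz'.
have /andP[_ /andP[_ /forall_inP pt]] := PiB_valP p.
have /eqP := implyP (pt _ (pblock_blocks p x)) nz'.
rewrite -(pblock_opp nz) -/(pointed p) !pointed_pblock opp_set1.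
by move/setP/(_ (rep p (opp_signed x))); rewrite !inE eqxx => /esym/eqP.
Qed.

(** The first equation expresses refinement, as the blocks are the fibres of [rep]; the second says
    that the pointed elements of [q], which form the image of [rep q], are pointed in [p]. *)
Lemma leB_rep p q : (p <= q)%O =
  [forall x, (rep q (rep p x) == rep q x) && (rep p (rep q x) == rep q x)].
Proof.
apply/andP/forallP => [[/forall_inP ref sub] x|pq].
  have -> : rep p (rep q x) = rep q x.
    by apply/eqP; rewrite -pointedE (subsetP sub) ?rep_pointed.
  have /exists_inP[C /blocks_pblock[y ->] /subsetP sBC] := ref _ (pblock_blocks p x).
  rewrite eqxx andbT.
  have := sBC _ (rep_pblock p x); rewrite mem_pblock_rep => /eqP ->.
  by have := sBC x; rewrite mem_pblock mem_cover_blocks mem_pblock_rep => /(_ isT) /eqP ->.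
split.
  apply/forall_inP => B /blocks_pblock[x ->]; apply/exists_inP.
  exists (pblock (blocks q) x); first exact: pblock_blocks.
  apply/subsetP => y; rewrite !mem_pblock_rep => /eqP exy.
  by have /andP[/eqP <- _] := pq x; have /andP[/eqP <- _] := pq y; rewrite exy.
apply/subsetP => x; rewrite !pointedE => /eqP ex.
by have /andP[_] := pq x; rewrite ex.
Qed.

Lemma rep_inj p q : rep p =1 rep q -> p = q.
Proof.
move=> epq; apply/le_anti; rewrite !leB_rep.
by apply/andP; split; apply/forallP => x; rewrite !epq rep_idem eqxx.
Qed.

(** The blocks are taken to be the fibres of [K] and the pointed elements its values. The conditions
    encode idempotence, opposite pointing off the zero block, stability of the zero block and its
    uniqueness. *)
Lemma exists_rep (K : signed n -> signed n) :
  (forall x, K (K x) = K x) ->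
  (forall x, K (opp_signed x) != K x -> K (opp_signed x) = opp_signed (K x)) ->
  (forall x y, K (opp_signed x) = K x -> K y = K x -> K (opp_signed y) = K x) ->
  (forall x y, K (opp_signed x) = K x -> K (opp_signed y) = K y -> K x = K y) ->
  exists p, rep p =1 K.
Proof.
move=> Kid Kopp Kst Kun.
pose P := preim_partition K [set: signed n].
pose A := [set K x | x : signed n].
have partP : partition P [set: signed n] := preim_partitionP _ _.
have PE B : reflect (exists x, B = [set y | K y == K x]) (B \in P).
  apply: (iffP imsetP) => [[x _ ->]|[x ->]]; exists x => //;
    by apply/setP => y; rewrite !inE /= eq_sym.
have zE x : is_zero_block [set y | K y == K x] = (K (opp_signed x) == K x).
  apply/exists_inP/eqP => [[y]|e]; last by exists x; rewrite inE ?e.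
  rewrite !inE => /eqP yx /eqP zy; rewrite -yx; apply: Kst => //.
  by rewrite zy.
have oppE x : K (opp_signed x) != K x ->
    opp_set [set y | K y == K x] = [set y | K y == K (opp_signed x)].
  move=> nz; have ex := Kopp _ nz.
  have ns y : K y = K x -> K (opp_signed y) != K y.
    move=> yx; apply: contra nz => /eqP zy.
    by rewrite (Kst y x) // yx.
  apply/setP => y; apply/imsetP/idP => [[z]|]; rewrite !inE => /eqP.
    by move=> zx ->; rewrite (Kopp z) ?zx ?ex ?eqxx // -zx; apply: ns.
  move=> yx; exists (opp_signed y); rewrite ?opp_signedK // inE.
  have [e|ne] := eqVneq (K (opp_signed y)) (K y); last first.
    by rewrite (Kopp _ ne) yx ex opp_signedK.
  case/eqP: nz; rewrite -{2}(opp_signedK x).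
  by rewrite (Kst y (opp_signed x)) // yx.
have AE x : A :&: [set y | K y == K x] = [set K x].
  apply/setP => y; rewrite !inE; apply/andP/eqP => [[/imsetP[z _ ->]]|->].
    by rewrite Kid => /eqP.
  by rewrite Kid imset_f.
have valid : partitionB (P, A).1 && pointing (P, A).1 (P, A).2.
  apply/andP; split; last first.
    apply/andP; split; apply/forall_inP => _ /PE[x ->]; first by rewrite AE cards1.
    apply/implyP; rewrite zE => nz.
    by rewrite oppE // !AE opp_set1 Kopp.
  apply/and4P; split=> //.
  - apply/forall_inP => _ /PE[x ->]; apply/forall_inP => _ /PE[y ->].
    rewrite !zE; apply/implyP => /eqP zx; apply/implyP => /eqP zy.
    by rewrite (Kun x y).
  - apply/forall_inP => _ /PE[x ->]; rewrite zE; apply/implyP => /eqP zx.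
    apply/eqP/setP => y; apply/imsetP/idP => [[z]|]; rewrite !inE => /eqP.
      by move=> zx' ->; rewrite (Kst x z).
    by move=> yx; exists (opp_signed y); rewrite ?opp_signedK // inE (Kst x y).
  apply/forall_inP => _ /PE[x ->]; rewrite zE; apply/implyP => nz.
  by rewrite oppE //; apply/PE; exists (opp_signed x).
exists (MkPiB valid) => x; apply/esym/rep_uniq; first exact: imset_f.
have -> : pblock (blocks (MkPiB valid)) x = [set y | K y == K x].
  apply: def_pblock; first by case/and3P: partP.
    by apply/PE; exists x.
  by rewrite inE.
by rewrite inE Kid.
Qed.

(** An index with both signs pointed lies outside the zero block, which has a single pointed
    element, so such indices correspond to the pairs of opposite non-zero blocks. *)
Lemma rankBE p : rankB p =
  (n - #|[set j | (rep p (j, true) == (j, true)) && (rep p (j, false) == (j, false))]|)%N.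
Proof.
rewrite /rankB; congr (n - _)%N.
pose J := [set j | (rep p (j, true) == (j, true)) && (rep p (j, false) == (j, false))].
rewrite -/J; pose B x := pblock (blocks p) x.
have JB j : j \in J -> B (j, false) = opp_set (B (j, true)).
  rewrite inE => /andP[/eqP t /eqP f].
  by rewrite /B -pblock_opp // /opp_signed /= t f; apply/eqP => -[].
rewrite -(card_in_imset (f := fun j => [set B (j, true); opp_set (B (j, true))]) (D := mem J)).
  apply: eq_card => X; apply/imsetP/imsetP => [[C + ->]|[j jJ ->]]; last first.
    exists (B (j, true)) => //; rewrite inE pblock_blocks /= zero_block_pblock.
    by move: jJ; rewrite inE => /andP[/eqP t /eqP f]; rewrite /opp_signed /= t f; apply/eqP => -[].
  rewrite inE => /andP[CP nz]; have [x ex] := blocks_pblock CP; rewrite ex zero_block_pblock in nz.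
  have ro := rep_opp nz.
  have Cs : C = B (rep p x).
    by rewrite ex; apply/esym; apply: same_pblock (blocks_trivIset p) (rep_pblock p x).
  have oCs : opp_set C = B (opp_signed (rep p x)).
    rewrite ex -pblock_opp // -ro; apply/esym.
    exact: same_pblock (blocks_trivIset p) (rep_pblock p _).
  have sJ : (rep p x).1 \in J.
    have f1 := rep_idem p x; have f2 := rep_idem p (opp_signed x); rewrite ro in f2.
    by move: f1 f2; rewrite /opp_signed; case: (rep p x) => j [] /= f1 f2; rewrite inE f1 f2 !eqxx.
  exists (rep p x).1 => //; rewrite -(JB _ sJ) oCs Cs.
  by rewrite /opp_signed; case: (rep p x) => j [] //=; rewrite setUC.
move=> j k jJ kJ /setP/(_ (B (j, true))); rewrite -!JB // !inE eqxx /=.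
move: jJ kJ; rewrite !inE => /andP[/eqP jt _] /andP[/eqP kt /eqP kf].
have jB : (j, true) \in B (j, true) by rewrite mem_pblock mem_cover_blocks.
by case/esym/orP => /eqP e; move: jB; rewrite e mem_pblock_rep jt ?kt ?kf => /eqP [].
Qed.

Lemma mem_PiBi p i :
  (p \in PiBi n i) = [forall x : signed n, (x.1 < i)%N ==> (rep p x == x)].
Proof. by rewrite inE; apply: eq_forallb => x; rewrite pointedE. Qed.

End Representative.

(** * The Moebius function as a signed count of partial functions *)

Section Weights.
Context {n : nat}.
Context (n_gt0 : (0 < n)%N).
Implicit Types (f : pfun n) (b p : PiB n) (x y s t o : signed n).

(* When [f] has no cycle there is no zero block to be pointed, and [merge f o] does not
   depend on [o]. *)
Definition zone f : {set signed n} := if zeros f == set0 then setT else zeros f.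

Definition merge f o : PiB n :=
  odflt \bot%O [pick p | [forall x, rep p x == odflt o (key (extend f) x)]].

Lemma zone_zeros f o x : o \in zone f -> x \in zeros f -> o \in zeros f.
Proof. by rewrite /zone; case: eqP => // ->; rewrite !inE. Qed.

(** The right-hand side satisfies the conditions of [exists_rep], so the default in [merge] is not
    reached. A root differs from its opposite, hence [x] and [- x] share a value only when they have
    no root. *)
Lemma rep_merge f o x : o \in zone f -> rep (merge f o) x = odflt o (key (extend f) x).
Proof.
move=> oz; pose K x := odflt o (key (extend f) x).
(* Idempotence at a rootless [y] needs [o] itself to be rootless, which [zone] ensures. *)
have keyo y : key (extend f) y = None -> key (extend f) o = None.
  by move=> ky; have := @zone_zeros f o y oz; rewrite !inE ky eqxx => /(_ isT)/eqP.
have zK y : K (opp_signed y) = K y -> key (extend f) y = None.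
  rewrite /K key_opp; case: (key _ y) => //= r /eqP.
  by rewrite (negPf (opp_signed_neq r)).
have [] := @exists_rep n K.
- move=> y; rewrite /K; case ky: (key _ y) => [r|] /=; last by rewrite (keyo y ky).
  by rewrite (key_root (key_rootP ky)).
- by move=> y; rewrite /K key_opp; case: (key _ y) => //= /eqP.
- move=> y z /zK ky; have ko := keyo _ ky; rewrite /K ky key_opp /=.
  case kz: (key _ z) => [r|] //= ero.
  by move: (key_root (key_rootP kz)); rewrite ero ko.
- by move=> y z /zK ky /zK kz; rewrite /K ky kz.
move=> p pK; rewrite /merge; case: pickP => [q /forallP/(_ x)/eqP //|/(_ p)/negP[]].
by apply/forallP => y; rewrite pK.
Qed.

Lemma rankB_merge f o : o \in zone f -> rankB (merge f o) = #|dom f|.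
Proof.
move=> oz; rewrite rankBE -[X in (X - _)%N](card_ord n) -(cardsC (dom f)).
suff -> : [set j | (rep (merge f o) (j, true) == (j, true)) &&
    (rep (merge f o) (j, false) == (j, false))] = ~: dom f by rewrite addnK.
apply/setP => j; rewrite !inE negbK !rep_merge //.
case fj: (f j) => [v|]; last by rewrite !key_root ?eqxx // /extend /= fj.
have nr c r : key (extend f) (j, c) = Some r -> r != (j, c).
  by move=> /key_rootP; apply: contra_eqN => /eqP ->; rewrite /extend /= fj.
case kt: (key _ _) => [r|]; first by rewrite /= (negPf (nr _ _ kt)).
case kf: (key _ _) => [r|]; first by rewrite /= (negPf (nr _ _ kf)) andbF.
(* Without roots both signs of [j] are sent to [o], which cannot equal both. *)
by apply/negbTE/negP => /andP[/eqP /= ->] /eqP.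
Qed.

Lemma card_zone_neq0 f : #|zone f|%:R != 0 :> rat.
Proof.
rewrite pnatr_eq0 /zone; case: ifP => [_|/negbT]; last by rewrite cards_eq0.
by rewrite cardsT card_prod card_ord card_bool muln_eq0 negb_or -lt0n n_gt0.
Qed.

(* Summed over [o] in [zone f], the weights of [f] add up to [(-1) ^+ #|dom f|]. *)
Definition weight f : rat := (-1) ^+ #|dom f| / #|zone f|%:R.

Definition moebius p : rat := \sum_f \sum_(o in zone f | merge f o == p) weight f.

(** The rank of [merge f o] depends on [f] only, so it remains to count the admissible [o]. The
    function [psi] is constant in the check of Moebius inversion and a power of the variable in the
    characteristic polynomials. *)
Lemma sum_moebius (V : lmodType rat) (S : {set PiB n}) (psi : nat -> V) :
  \sum_(p in S) moebius p *: psi (rankB p) =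
  \sum_f (weight f * #|[set o in zone f | merge f o \in S]|%:R) *: psi #|dom f|.
Proof.
under eq_bigr do rewrite scaler_suml.
rewrite exchange_big; apply: eq_bigr => f _ /=.
under eq_bigr => p _.
  rewrite scaler_suml.
  rewrite (eq_bigr (fun _ => weight f *: psi #|dom f|)); last first.
    by move=> o /andP[oz /eqP <-]; rewrite rankB_merge.
  over.
rewrite (exchange_big_dep (mem (zone f))) /=; last by move=> p o _ /andP[].
rewrite mulr_natr -scalerMnl -sumr_const big_mkcond [RHS]big_mkcond.
apply: eq_bigr => o _; rewrite inE; case: (o \in zone f) => //=.
case: ifP => oS; last by rewrite big1 // => p /andP[pS /eqP ep]; rewrite ep pS in oS.
rewrite (big_pred1 (merge f o)) // => p.
by rewrite eq_sym /=; case: eqP => [->|]; rewrite ?oS ?andbF.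
Qed.

(** The refinement half of [merge f o <= b], which does not depend on [o]. *)
Definition compatible b f : bool :=
  [forall x, if extend f x is Some y then rep b y == rep b x else true] &&
  (zeros f \subset [set x | rep b (opp_signed x) == rep b x]).

Lemma rep_compatible b f x y : compatible b f -> extend f x = Some y -> rep b y = rep b x.
Proof. by case/andP => /forallP/(_ x) + _ fx; rewrite fx => /eqP. Qed.

Lemma key_compatible b f x r : compatible b f -> key (extend f) x = Some r ->
  rep b r = rep b x.
Proof.
move=> cf; move: x r; apply: key_ind => // x y r fx _ ->.
exact: rep_compatible fx.
Qed.

Lemma zeros_compatible b f x : compatible b f -> x \in zeros f ->
  rep b (opp_signed x) = rep b x.
Proof. by case/andP => _ /subsetP sub /sub; rewrite inE => /eqP. Qed.

(** Beyond refinement, each pointed element of [b] must be pointed in [merge f o]: it is either a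
    root of [f] or the point [o] of the zero block. *)
Lemma merge_le b f o : o \in zone f -> (merge f o <= b)%O = compatible b f &&
  [forall x, (rep b x == x) ==> (extend f x == None) || (x == o) && (x \in zeros f)].
Proof.
move=> oz; rewrite leB_rep; apply/forallP/andP => [H|[cf /forallP H] x].
  have H1 x : rep b (odflt o (key (extend f) x)) = rep b x.
    by have /andP[/eqP + _] := H x; rewrite rep_merge.
  split; first (apply/andP; split).
  - apply/forallP => x; case fx: (extend f x) => [y|] //.
    by rewrite -H1 -[X in _ == X]H1 (key_step fx).
  - apply/subsetP => x; rewrite !inE => /eqP kx.
    by rewrite -H1 -[X in _ == X]H1 key_opp kx.
  apply/forallP => x; apply/implyP => /eqP bx.
  have /andP[_] := H x; rewrite bx rep_merge // inE.
  case kx: (key _ x) => [r|] /=; last by rewrite eq_sym orbC => ->.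
  by move=> /eqP <-; rewrite (key_rootP kx) eqxx.
rewrite !rep_merge //; apply/andP; split.
  case kx: (key _ x) => [r|] /=; first by rewrite (key_compatible cf kx).
  have xz : x \in zeros f by rewrite inE kx.
  have oz' := zone_zeros oz xz.
  by apply/eqP/rep_zero_uniq; apply: (zeros_compatible cf).
have := H (rep b x); rewrite rep_idem eqxx /= => /orP[/eqP fx|/andP[/eqP -> +]].
  by rewrite key_root.
by rewrite inE => /eqP ->.
Qed.

(** * Pointed partitions with a zero block *)

Section ZeroBlock.
Context (b : PiB n) (s : signed n).
Context (bs : rep b s = s) (bos : rep b (opp_signed s) = s).

Definition compatible_off f : bool := compatible b f &&
  [forall x, (rep b x == x) && (x != s) ==> (extend f x == None)].

(** [s] is the only pointed element of [b] that can lie in [zeros f], because [zeros f] is contained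
    in the zero block of [b]. *)
Lemma merge_le_zero f o : o \in zone f -> (merge f o <= b)%O =
  compatible_off f && ((f s.1 == None) || (s == o) && (s \in zeros f)).
Proof.
move=> oz; rewrite merge_le // /compatible_off -andbA.
case cf: (compatible b f) => //=.
apply/forallP/andP => [H|[/forallP H Hs] x].
  split; last by have := H s; rewrite bs eqxx extend_None.
  apply/forallP => x; apply/implyP => /andP[/eqP bx xs].
  have := H x; rewrite bx eqxx /= => /orP[//|/andP[_ xz]].
  have bxo := zeros_compatible cf xz.
  have bsz : rep b (opp_signed s) = rep b s by rewrite bs.
  by case/eqP: xs; rewrite -bs -bx; apply: rep_zero_uniq.
apply/implyP => bx; have [->|xs] := eqVneq x s; first by rewrite extend_None.
by have := H x; rewrite bx xs => /= ->.
Qed.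

Lemma count_le_zero f : #|[set o in zone f | merge f o \in [set a | (a <= b)%O]]| =
  if compatible_off f then
    if f s.1 == None then #|zone f| else (s \in zeros f) : nat
  else 0%N.
Proof.
have -> : [set o in zone f | merge f o \in [set a | (a <= b)%O]] =
    [set o in zone f | compatible_off f &&
       ((f s.1 == None) || (s == o) && (s \in zeros f))].
  apply/setP => o; rewrite [LHS]inE [RHS]inE [X in _ && X = _]inE.
  by case: (boolP (o \in zone f)) => //= /merge_le_zero ->.
case: ifP => _; last by apply: eq_card0 => o; rewrite !inE andbF.
case: ifP => _ /=; first by apply: eq_card => o; rewrite !inE andbT.
case: (boolP (s \in zeros f)) => sz; last by apply: eq_card0 => o; rewrite !inE !andbF.
rewrite /= -(cards1 s); apply: eq_card => o; rewrite !inE andbT [s == o]eq_sym.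
case: eqP => [->|_]; last by rewrite andbF.
by rewrite andbT /zone; case: eqP => // _; rewrite inE.
Qed.

Lemma compatible_off_update f v : f s.1 = None -> v \in absorbed f s ->
  compatible_off (update f s v) = compatible_off f.
Proof.
move=> fs vA; have zu := zeros_update v fs; rewrite vA in zu.
have ext x y : extend f x = Some y -> extend (update f s v) x = Some y.
  move=> fx; rewrite extend_updateE.
  case: eqVneq => [ex|_]; first by rewrite ex /extend fs in fx.
  by case: eqVneq => [ex|_] //; rewrite ex extend_opp /extend fs in fx.
apply/idP/idP => [/andP[cu /forallP H]|/andP[cf /forallP H]].
  apply/andP; split; first (apply/andP; split).
  - apply/forallP => x; case fx: (extend f x) => [y|] //.
    by rewrite (rep_compatible cu (ext _ _ fx)).
  - case/andP: cu => _; rewrite zu; apply: subset_trans.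
    by apply/subsetP => x; rewrite !inE => /eqP ->.
  apply/forallP => x; apply/implyP => /(implyP (H x)).
  by apply: contraTT; case fx: (extend f x) => [y|] // _; rewrite (ext _ _ fx).
(* Everything absorbed lies in the zero block of [b], so the new arrow and the enlarged zero block
   respect [b]. *)
have sA x : x \in absorbed f s -> rep b x = s /\ rep b (opp_signed x) = s.
  case kx: (key (extend f) x) => [r|].
    rewrite (in_absorbed _ kx) => rs.
    have bx : rep b x = rep b s.
      by rewrite -(key_compatible cf kx) bs; case/orP: rs => /eqP ->.
    by split; [rewrite bx | rewrite -[RHS]bs; apply: rep_zero_stable; rewrite ?bx ?bs].
  move=> _; have xz : x \in zeros f by rewrite inE kx.
  have bx := zeros_compatible cf xz; rewrite bx; split=> //;
    by rewrite -[RHS]bs; apply: rep_zero_uniq; rewrite ?bs.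
apply/andP; split; first (apply/andP; split).
- apply/forallP => x; rewrite extend_updateE.
  case: eqVneq => [->|_]; first by rewrite (sA _ vA).1 bs.
  case: eqVneq => [->|_]; first by rewrite (sA _ vA).2 bos.
  by case fx: (extend f x) => [y|] //; rewrite (rep_compatible cf fx).
- by rewrite zu; apply/subsetP => x /sA[bx box]; rewrite inE bx box.
apply/forallP => x; apply/implyP => /andP[bx xs].
rewrite extend_updateE (negPf xs); case: (eqVneq x (opp_signed s)) => [ex|_].
  by case/eqP: xs; rewrite -(eqP bx) ex bos.
by apply: (implyP (H x)); rewrite bx xs.
Qed.

(** By [sum_zeros] each [f] with root [s] also collects the terms of its extensions with [s] in the
    zero block, of rank one higher and opposite sign. The difference vanishes for constant [psi] and
    produces the factor ['X - 1] for powers of ['X]. *)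
Lemma sum_moebius_zero (V : lmodType rat) (psi : nat -> V) :
  \sum_(a in [set a | (a <= b)%O]) moebius a *: psi (rankB a) =
  \sum_(f : pfun n | (f s.1 == None) && compatible_off f)
     (-1) ^+ #|dom f| *: (psi #|dom f| - psi #|dom f|.+1).
Proof.
rewrite sum_moebius (bigID (fun f : pfun n => f s.1 == None)) /=.
pose G f : V := if compatible_off f then
  (-1) ^+ #|dom f|.+1 *: psi #|dom f|.+1 else 0.
have -> : \sum_(f : pfun n | f s.1 != None)
    (weight f * #|[set o in zone f | merge f o \in [set a | (a <= b)%O]]|%:R) *: psi #|dom f|
    = \sum_(f : pfun n | s \in zeros f) #|zeros f|%:R^-1 *: G (erase s.1 f).
  rewrite big_mkcond [RHS]big_mkcond; apply: eq_bigr => f _.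
  rewrite count_le_zero.
  case: (boolP (f s.1 == None)) => [/eqP fs|fs] /=.
    by rewrite inE key_root // /extend fs.
  case: (boolP (s \in zeros f)) => sz; last by rewrite if_same mulr0 scale0r.
  have [v fv] : exists v, extend f s = Some v.
    by case fv: (extend f s) (extend_None f s) fs => [v|]; [exists v | move=> <-].
  have ef := update_erase fv.
  have es : erase s.1 f s.1 = None by rewrite ffunE eqxx.
  have vA : v \in absorbed (erase s.1 f) s.
    move: sz; rewrite -{1}ef zeros_update //; case: ifP => // _.
    by rewrite inE key_root // /extend es.
  rewrite /G -(compatible_off_update es vA) ef.
  case: ifP => _; last by rewrite mulr0 scale0r scaler0.
  rewrite -(dom_update v es) ef mulr1 scalerA mulrC /weight /zone; case: eqP => // z0.
  by rewrite z0 inE in sz.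
rewrite sum_zeros -big_split /= big_mkcondr; apply: eq_bigr => f fs.
rewrite count_le_zero fs /G; case: ifP => _; last by rewrite mulr0 scale0r addr0.
by rewrite /weight divfK ?card_zone_neq0 // exprS mulN1r scaleNr -scalerBr.
Qed.

End ZeroBlock.

(** * Pointed partitions without zero block *)

Section NoZeroBlock.
Context (b : PiB n) (s : signed n).
Context (bnz : forall x, rep b (opp_signed x) != rep b x) (bs : rep b s = s).

Definition compatible_all f : bool := compatible b f &&
  [forall x, (rep b x == x) ==> (extend f x == None)].

(** A cycle of a compatible [f] would force a zero block in [b]; hence whether [merge f o] lies
    below [b] is decided by [f] alone. *)
Lemma count_le_nonzero f : #|[set o in zone f | merge f o \in [set a | (a <= b)%O]]| =
  if compatible_all f then #|zone f| else 0%N.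
Proof.
have eqle o : o \in zone f -> (merge f o <= b)%O = compatible_all f.
  move=> oz; rewrite merge_le // /compatible_all; case cf: (compatible b f) => //=.
  apply: eq_forallb => x; case: (boolP (x \in zeros f)) => xz; last by rewrite andbF orbF.
  by have := bnz x; rewrite (zeros_compatible cf xz) eqxx.
case: ifP => cf; last first.
  by apply: eq_card0 => o; rewrite !inE; apply/negP => /andP[/eqle ->]; rewrite cf.
by apply: eq_card => o; rewrite !inE andb_idr // => /eqle ->.
Qed.

Definition free f : {set signed n} :=
  [set t | [&& rep b t == s, t != s & extend f t \in [:: None; Some s]]].

Lemma update_free f t : rep b t = s -> t != s -> f t.1 = None ->
  compatible_all (update f t s) = compatible_all f /\ free (update f t s) = free f.
Proof.
move=> bt ts ft; have bot : rep b (opp_signed t) = opp_signed s.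
  by rewrite (rep_opp (bnz t)) bt.
have bost : rep b (opp_signed s) = opp_signed s by rewrite (rep_opp (bnz s)) bs.
have sos := opp_signed_neq s.
have ext x y : extend f x = Some y -> extend (update f t s) x = Some y.
  move=> fx; rewrite extend_updateE.
  case: eqVneq => [ex|_]; first by rewrite ex /extend ft in fx.
  by case: eqVneq => [ex|_] //; rewrite ex extend_opp /extend ft in fx.
split; last first.
  apply/setP => u; rewrite !inE extend_updateE.
  have [->|ut] := eqVneq u t; first by rewrite /= /extend ft /= eqxx.
  by have [->|//] := eqVneq u (opp_signed t); rewrite bot (negPf sos).
apply/idP/idP => [/andP[cu /forallP H]|/andP[cf /forallP H]].
  apply/andP; split; first (apply/andP; split).
  - apply/forallP => x; case fx: (extend f x) => [y|] //.
    by rewrite (rep_compatible cu (ext _ _ fx)).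
  - case/andP: cu => _; apply: subset_trans; rewrite zeros_update //.
    case: ifP => // _; apply/subsetP => x; rewrite !inE => /eqP -> //.
  apply/forallP => x; apply/implyP => /(implyP (H x)).
  by apply: contraTT; case fx: (extend f x) => [y|] // _; rewrite (ext _ _ fx).
apply/andP; split; first (apply/andP; split).
- apply/forallP => x; rewrite extend_updateE.
  case: eqVneq => [->|_]; first by rewrite bs bt.
  case: eqVneq => [->|_]; first by rewrite bost bot.
  by case fx: (extend f x) => [y|] //; rewrite (rep_compatible cf fx).
- rewrite zeros_update //.
  (* [s] is a root other than [t] and [- t], so sending [t] to [s] closes no cycle. *)
  have ks : key (extend f) s = Some s.
    by apply/key_root/eqP/(implyP (H s)); rewrite bs.
  rewrite (in_absorbed _ ks) [s == t]eq_sym (negPf ts) /=.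
  case: eqVneq => [es|_]; last by case/andP: cf.
  by move: bot; rewrite -es bs => /eqP; rewrite eq_sym (negPf sos).
apply/forallP => x; apply/implyP => bx; rewrite extend_updateE.
case: (eqVneq x t) => [ex|_]; first by move: bx ts; rewrite ex bt eq_sym => ->.
case: (eqVneq x (opp_signed t)) => [ex|_]; last exact: implyP (H x) bx.
by move: bx ts; rewrite ex bot (inj_eq (can_inj opp_signedK)) eq_sym => ->.
Qed.

(** Follow [x] to its root, which exists since [b] has no zero block: a root other than [s] is free
    itself, and if the root is [s], the last vertex before it is free. *)
Lemma free_neq0 f x : compatible_all f -> rep b x = s -> x != s -> exists t, t \in free f.
Proof.
move=> /andP[cf /forallP H] bx xs.
have fs : extend f s = None by apply/eqP/(implyP (H s)); rewrite bs.
case kx: (key (extend f) x) => [r|]; last first.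
  have /(zeros_compatible cf) : x \in zeros f by rewrite inE kx.
  by move/eqP; rewrite (negPf (bnz x)).
have br := key_compatible cf kx; have fr := key_rootP kx.
have [er|nr] := eqVneq r s; last by exists r; rewrite inE br bx eqxx nr fr.
rewrite {r}er in kx br fr.
suff [t ft bt] : exists2 t, extend f t = Some s & rep b t = rep b x.
  exists t; rewrite inE bt bx eqxx ft !inE eqxx orbT andbT /=.
  by apply: contra_eqN ft => /eqP ->; rewrite fs.
suff last_step : forall y r, key (extend f) y = Some r -> y != r ->
  exists2 t, extend f t = Some r & rep b t = rep b y by exact: last_step kx xs.
apply: key_ind => [y _|y z r fy _ IH _]; first by rewrite eqxx.
have [<-|zr] := eqVneq z r; first by exists y.
by have [t ft bt] := IH zr; exists t; rewrite // bt (rep_compatible cf fy).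
Qed.

(* Attaching the root [t] to [s] or detaching it changes the sign but not [free f], so the
   same [t] is picked the second time. *)
Definition toggle f : pfun n :=
  if [pick t in free f] is Some t then
    if f t.1 == None then update f t s else erase t.1 f
  else f.

Lemma toggle_free f t : t \in free f -> f t.1 != None ->
  exists2 h : pfun n, h t.1 = None & f = update h t s /\ erase t.1 f = h.
Proof.
rewrite inE !inE => /and3P[_ _ /orP[|/eqP ft _]].
  by rewrite extend_None => ->.
exists (erase t.1 f); first by rewrite ffunE eqxx.
by rewrite update_erase.
Qed.

Lemma toggleP f x : compatible_all f -> rep b x = s -> x != s ->
  [/\ compatible_all (toggle f), toggle (toggle f) = f &
      (-1) ^+ #|dom (toggle f)| = - (-1) ^+ #|dom f| :> rat].
Proof.
move=> cf bx xs; have [t0 t0U] := free_neq0 cf bx xs.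
have [t tU pk] : exists2 t, t \in free f & [pick t in free f] = Some t.
  by case: pickP => [t tU|/(_ t0)]; [exists t | rewrite t0U].
have toggleE h : free h = free f ->
    toggle h = if h t.1 == None then update h t s else erase t.1 h.
  by move=> eU; rewrite /toggle eU pk.
have [bt ts] : rep b t = s /\ t != s by move: (tU); rewrite inE => /and3P[/eqP].
have [/eqP ft|ft] := boolP (f t.1 == None).
  have [cE fE] := update_free bt ts ft.
  have tf : toggle f = update f t s by rewrite toggleE // ft.
  rewrite tf cE toggleE //; split=> //; last by rewrite dom_update // exprS mulN1r.
  by rewrite ffunE eqxx /= erase_update.
have [h ht [fE hE]] := toggle_free tU ft.
have [cE UE] := update_free bt ts ht.
have tf : toggle f = h by rewrite toggleE // (negPf ft).
rewrite tf -cE -fE; split=> //; last by rewrite fE dom_update // exprS mulN1r opprK.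
by rewrite toggleE -?UE -?fE // ht.
Qed.

Lemma sum_sign_compatible x : rep b x = s -> x != s ->
  \sum_(f : pfun n | compatible_all f) (-1) ^+ #|dom f| = 0 :> rat.
Proof.
move=> bx xs; set S := LHS.
have : S = - S.
  rewrite {1}/S (reindex_onto toggle toggle) /=; last first.
    by move=> f cf; have [] := toggleP cf bx xs.
  rewrite /S -sumrN; apply: eq_big => [f|f /andP[cf /eqP tf]].
    apply/andP/idP => [[ct /eqP <-]|cf]; first by have [] := toggleP ct bx xs.
    by have [-> -> _] := toggleP cf bx xs.
  have [_ _] := toggleP cf bx xs; rewrite tf => ->; by rewrite opprK.
by move/eqP; rewrite -subr_eq0 opprK -mulr2n mulrn_eq0 /= => /eqP.
Qed.

End NoZeroBlock.
(** * Characteristic polynomials *)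

Lemma rep_bot x : rep \bot%O x = x.
Proof.
apply/eqP; rewrite -pointedE.
by have -> : pointed (\bot%O : PiB n) = [set: signed n] by []; rewrite inE.
Qed.

Lemma rankB_bot : rankB (\bot%O : PiB n) = 0%N.
Proof.
rewrite rankBE (_ : [set j | _] = [set: 'I_n]) ?cardsT ?card_ord ?subnn //.
by apply/setP => j; rewrite !inE !rep_bot !eqxx.
Qed.

Lemma merge_bot f o : o \in zone f -> (merge f o == \bot%O) = (dom f == set0).
Proof.
move=> oz; rewrite -cards_eq0 -(rankB_merge oz); apply/eqP/eqP => [->|].
  exact: rankB_bot.
rewrite rankB_merge // => /cards0_eq d0; apply: rep_inj => x.
rewrite rep_merge // rep_bot key_root //.
have : x.1 \notin dom f by rewrite d0 inE.
by rewrite inE negbK -extend_None => /eqP.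
Qed.

Lemma moebius_bot : moebius \bot%O = 1.
Proof.
rewrite /moebius (bigD1 [ffun=> None]) //= [X in _ + X]big1 ?addr0.
  have d0 : dom ([ffun=> None] : pfun n) = set0.
    by apply/setP => j; rewrite !inE ffunE.
  rewrite (eq_bigl (mem (zone [ffun=> None]))); last first.
    move=> o /=; case: (boolP (o \in _)) => //= oz.
    by rewrite merge_bot // d0 eqxx.
  by rewrite sumr_const /weight d0 cards0 expr0 -[LHS]mulr_natr divfK // card_zone_neq0.
move=> f nf; rewrite big_pred0 // => o; apply/negP => /andP[oz].
rewrite merge_bot // => /eqP d0; case/eqP: nf; apply/ffunP => j; rewrite ffunE.
by have : j \notin dom f; [rewrite d0 inE | rewrite inE negbK => /eqP].
Qed.

Lemma sum_moebius_le b : \sum_(a | (a <= b)%O) moebius a = (b == \bot%O)%:R.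
Proof.
have [->|nb] := eqVneq b \bot%O.
  by rewrite (big_pred1 \bot%O) ?moebius_bot // => a; rewrite lex0.
have toS : \sum_(a | (a <= b)%O) moebius a =
    \sum_(a in [set a | (a <= b)%O]) moebius a *: (1 : rat^o).
  by apply: eq_big => [a|a _]; rewrite ?inE // [RHS]mulr1.
rewrite toS; have [/existsP[x /eqP zx]|/existsPn nz] :=
    boolP [exists x, rep b (opp_signed x) == rep b x].
  rewrite (@sum_moebius_zero b (rep b x) _ _ _ (fun=> 1)) ?rep_idem //.
    by rewrite big1 // => f _; rewrite subrr scaler0.
  by apply: rep_zero_stable => //; rewrite rep_idem.
have [x bx] : exists x, rep b x != x.
  apply/existsP; apply: contraR nb; rewrite negb_exists => /forallP H.
  by apply/eqP/rep_inj => x; rewrite rep_bot; apply/eqP; have := H x; rewrite negbK.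
rewrite (sum_moebius _ (fun=> 1)) /=.
rewrite -[RHS](@sum_sign_compatible b (rep b x) nz (rep_idem b x) x erefl); last by rewrite eq_sym.
rewrite [RHS]big_mkcond; apply: eq_bigr => f _; rewrite count_le_nonzero //.
by case: ifP => _; rewrite [LHS]mulr1 ?mulr0 // /weight divfK ?card_zone_neq0.
Qed.

Lemma map_char_poly_poset (S : {set PiB n}) :
  (forall a b, (a <= b)%O -> b \in S -> a \in S) ->
  map_poly intr (char_poly_poset S (@rankB n)) =
  \sum_(a in S) moebius a *: 'X^(\max_(b in S) rankB b - rankB a) :> {poly rat}.
Proof.
move=> lowS; rewrite /char_poly_poset rmorph_sum; apply: eq_bigr => a aS.
by rewrite /= map_polyZ map_polyXn /= (mobius_lower_set lowS sum_moebius_le aS).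
Qed.

Lemma card_ord_lt i : (i <= n)%N -> #|[set j : 'I_n | (j < i)%N]| = i.
Proof.
move=> lein; rewrite -sum1_card (eq_bigl (fun j : 'I_n => j < i)%N); last first.
  by move=> j; rewrite inE.
by rewrite -(big_ord_widen n (fun=> 1%N) lein) sum1_card card_ord.
Qed.

Lemma max_rankB_PiBi i : (i <= n)%N -> (\max_(p in PiBi n i) rankB p = n - i)%N.
Proof.
move=> lein; apply/eqP; rewrite eqn_leq; apply/andP; split.
  apply/bigmax_leqP => p; rewrite mem_PiBi => /forallP H.
  rewrite rankBE leq_sub2l // -[leqLHS](card_ord_lt lein).
  apply/subset_leq_card/subsetP => j; rewrite !inE => ji.
  by rewrite !(implyP (H (j, _)) ji).
(* The bound is attained by keeping the first [i] pairs as singletons and merging the rest, if any,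
   into a zero block pointed at [n], whose 0-based index is [n.-1]. *)
have lt_n : (n.-1 < n)%N by rewrite prednK.
pose top : signed n := (Ordinal lt_n, true).
pose K x : signed n := if (x.1 < i)%N then x else top.
have zK x : K (opp_signed x) = K x -> (x.1 < i)%N = false.
  by rewrite /K /=; case: ifP => // _ /eqP; rewrite (negPf (opp_signed_neq x)).
have KN x : (x.1 < i)%N = false -> K x = top by rewrite /K => ->.
have [] := @exists_rep n K.
- by move=> x; rewrite /K; case xi: (x.1 < i)%N; rewrite ?xi //; case: ifP.
- by move=> x; rewrite /K /=; case: ifP => //; rewrite eqxx.
- move=> x y /zK xi; rewrite (KN x) // => ey; apply: KN => /=.
  move: ey; rewrite /K; case: (boolP (y.1 < i)%N) => [yi ey|/negPf //].
  (* Here [y] would be [top] with index below [i], forcing [i = n] and leaving no index for [x]. *)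
  move: xi; rewrite (leq_trans _ yi) // ey /= ltnS -ltnS prednK //.
- by move=> x y /zK xi /zK yi; rewrite !KN.
move=> p pK; have pS : p \in PiBi n i.
  by rewrite mem_PiBi; apply/forallP => x; apply/implyP => xi; rewrite pK /K xi.
apply: leq_trans (leq_bigmax_cond _ pS); rewrite rankBE leq_sub2l //.
rewrite -[leqRHS](card_ord_lt lein).
apply/subset_leq_card/subsetP => j; rewrite !inE !pK /K /=.
by case: (j < i)%N => //= /andP[/eqP -> /eqP].
Qed.

Lemma char_poly_PiBi i : (i <= n)%N ->
  map_poly intr (char_poly_poset (PiBi n i) (@rankB n)) =
  ('X - ((2 * n)%:R)%:P) ^+ (n - i) :> {poly rat}.
Proof.
move=> lein; rewrite map_char_poly_poset; last first.
  move=> a b; rewrite leB_rep !mem_PiBi => /forallP ab /forallP H.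
  apply/forallP => x; apply/implyP => /(implyP (H x)) /eqP bx.
  by have /andP[_] := ab x; rewrite bx.
rewrite (sum_moebius _ (fun k => 'X^(_ - k))) max_rankB_PiBi //.
pose A := [set j : 'I_n | (i <= j)%N].
have cA : #|A| = (n - i)%N.
  apply/eqP; rewrite -(eqn_add2l i) subnKC // -{1}(card_ord_lt lein).
  rewrite -[X in _ == X](card_ord n) -(cardsC [set j : 'I_n | (j < i)%N]); apply/eqP.
  by congr (_ + _)%N; apply: eq_card => j; rewrite !inE -leqNgt.
rewrite -cA polyC_natr -sum_partial_functions big_mkcond [RHS]big_mkcond.
apply: eq_bigr => f _.
(* An index in the domain of [f] is not pointed with both signs, so membership depends on [dom f]
   alone. *)
have cE o : o \in zone f -> (merge f o \in PiBi n i) = (dom f \subset A).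
  move=> oz; rewrite mem_PiBi; apply/forallP/subsetP => [H j|H x].
    rewrite !inE leqNgt => fj; apply/negP => ji.
    have root c r : key (extend f) (j, c) = Some r -> r != (j, c).
      by move=> /key_rootP/eqP kr; apply: contraNneq fj => er; rewrite er extend_None in kr.
    have := implyP (H (j, true)) ji; have := implyP (H (j, false)) ji.
    rewrite !rep_merge //.
    case kf: (key _ (j, false)) => [r|]; first by rewrite /= (negPf (root _ _ kf)).
    case kt: (key _ (j, true)) => [r|]; first by rewrite /= (negPf (root _ _ kt)).
    by move=> /eqP /= -> /eqP.
  apply/implyP => xi; rewrite rep_merge // key_root //=.
  apply/eqP; rewrite extend_None; apply: contraLR xi => fx.
  by have := H x.1; rewrite !inE -leqNgt => /(_ fx).
have -> : [set o in zone f | merge f o \in PiBi n i] = [set o in zone f | dom f \subset A].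
  apply/setP => o; rewrite [LHS]inE [RHS]inE.
  by case: (boolP (o \in zone f)) => // /cE ->.
case: ifP => fA.
  have -> : [set o in zone f | true] = zone f by apply/setP => o; rewrite inE andbT.
  by rewrite /weight divfK ?card_zone_neq0 // -mul_polyC rmorph_sign.
rewrite (_ : [set _ in _ | _] = set0) ?cards0 ?mulr0 ?scale0r //.
by apply/setP => o; rewrite !inE andbF.
Qed.

(** Any [alpha] lies below the one-block partition pointed at a pointed element of [alpha], so
    maximality makes them equal. *)
Lemma maximal_rep alpha : is_maximal alpha ->
  exists s, forall x, rep alpha x = s.
Proof.
move=> maxa; pose x0 : signed n := (Ordinal n_gt0, true).
pose s := rep alpha x0; exists s.
have [] := @exists_rep n (fun=> s) => // [x|p pK]; first by rewrite eqxx.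
have lep : (alpha <= p)%O.
  by rewrite leB_rep; apply/forallP => x; rewrite !pK eqxx rep_idem eqxx.
have := maxa p; rewrite lt_neqAle lep andbT negbK => /eqP ->.
exact: pK.
Qed.

Lemma char_poly_interval alpha : is_maximal alpha ->
  map_poly intr (char_poly_poset (down_interval alpha) (@rankB n)) =
  ('X - 1) * ('X - ((2 * n)%:R)%:P) ^+ (n - 1) :> {poly rat}.
Proof.
move=> /maximal_rep[s as_].
have -> : down_interval alpha = [set a | (a <= alpha)%O].
  by apply/setP => a; rewrite !inE le0x.
have max_r : (\max_(b in [set a | (a <= alpha)%O]) rankB b)%N = n.
  apply/eqP; rewrite eqn_leq; apply/andP; split.
    by apply/bigmax_leqP => p _; rewrite rankBE leq_subr.
  have aS : alpha \in [set a | (a <= alpha)%O] by rewrite inE.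
  apply: leq_trans (leq_bigmax_cond _ aS).
  rewrite rankBE (_ : [set j | _] = set0) ?cards0 ?subn0 //.
  by apply/setP => j; rewrite !inE !as_; apply/negP => /andP[/eqP -> /eqP].
rewrite map_char_poly_poset; last first.
  by move=> a b; rewrite !inE; apply: le_trans.
rewrite (@sum_moebius_zero alpha s (as_ _) (as_ _) _ (fun k => 'X^(_ - k))) max_r.
pose A : {set 'I_n} := [set~ s.1].
have cA : #|A| = (n - 1)%N by rewrite cardsC1 card_ord subn1.
rewrite -cA polyC_natr -sum_partial_functions mulr_sumr.
apply: eq_big => [f|f /andP[fs _]].
  have -> : compatible_off alpha s f.
    apply/andP; split; first (apply/andP; split).
    - by apply/forallP => x; case: (extend f x) => // y; rewrite !as_.
    - by apply/subsetP => x _; rewrite inE !as_.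
    by apply/forallP => x; rewrite as_ eq_sym andbN.
  by rewrite andbT subsetC sub1set !inE negbK.
(* The bound keeps the truncated subtractions exact, so that ['X^(n - k) - 'X^(n - k.+1)] factors as
   [('X - 1) * 'X^(n - 1 - k)]. *)
have domA : (#|dom f| <= n - 1)%N.
  rewrite -cA subset_leq_card //; apply/subsetP => j; rewrite !inE.
  by apply: contraNneq => ->.
rewrite -mul_polyC rmorph_sign mulrCA; congr (_ * _).
rewrite cA mulrBl mul1r -exprS; congr ('X^_ - 'X^_).
  by rewrite -subSn // subn1 prednK.
by rewrite subnAC subn1 -subnS.
Qed.

End Weights.

Theorem theorem1p6 (n : nat) (n_ge1 : (1 <= n)%N) :
  (forall i : nat, (i <= n)%N ->
     char_poly_poset (PiBi n i) (@rankB n)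
       = ('X - ((2 * n)%:R)%:P) ^+ (n - i) :> {poly int}
     /\ (char_poly_poset (PiBi n i) (@rankB n))`_0
       = (- (2 * n)%:R) ^+ (n - i) :> int)
  /\
  (forall alpha : PiB n, is_maximal alpha ->
     char_poly_poset (down_interval alpha) (@rankB n)
       = ('X - 1) * ('X - ((2 * n)%:R)%:P) ^+ (n - 1) :> {poly int}
     /\ (char_poly_poset (down_interval alpha) (@rankB n))`_0
       = (-1) ^+ n * (2 * n)%:R ^+ (n - 1) :> int).
Proof.
(* The identities hold over the rationals, where the weights live, and descend by injectivity. *)
have map_inj : injective (map_poly (intr : int -> rat)).
  by apply: map_inj_poly; [exact: intr_inj | rewrite rmorph0].
have mapXB : map_poly (intr : int -> rat) ('X - ((2 * n)%:R)%:P) =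
    'X - ((2 * n)%:R)%:P.
  by rewrite rmorphB /= map_polyX map_polyC /= rmorph_nat.
split=> [i lein|alpha maxa].
  have -> : char_poly_poset (PiBi n i) (@rankB n) = ('X - ((2 * n)%:R)%:P) ^+ (n - i).
    by apply: map_inj; rewrite char_poly_PiBi // rmorphXn /= mapXB.
  by split=> //; rewrite -horner_coef0 !hornerE.
have -> : char_poly_poset (down_interval alpha) (@rankB n) =
    ('X - 1) * ('X - ((2 * n)%:R)%:P) ^+ (n - 1).
  apply: map_inj; rewrite char_poly_interval // rmorphM rmorphXn /= mapXB.
  by rewrite rmorphB /= map_polyX rmorph1.
(* At [0] the factor ['X - 1] contributes the [-1] that completes the sign to [(-1) ^+ n]. *)
split=> //; rewrite -horner_coef0 !hornerE.
by rewrite [in LHS]exprNn mulrA -exprS subn1 prednK.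
Qed.
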